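(* There is an absolute constant $C>0$ with the following property. Let $U$ be a finite set, and let $\mu$ be a $k$-spread probability measure on $2^U$, where $k\ge 1$ is a real number, whose support $\mathcal F$ satisfies $\mathrm{VC}(\mathcal F)\le d$ for an integer $d\ge1$. For $0<\varepsilon\le 1/2$, set $$p=\min\left\{1,\;\frac{C}{k}\log\frac{d+1}{\varepsilon}\right\}.$$ If $W\sim\mathrm{Bin}(U,p)$, then $\Pr_W[\exists S\in\mathcal F: S\subseteq W]\ge 1-\varepsilon$.
   Context: $\log$ is the natural logarithm. $W\sim\mathrm{Bin}(U,p)$ means that each point of the finite set $U$ is included in the random set $W$ independently with probability $p$. For a real number $k\ge1$, a probability measure $\mu$ on $2^U$ is $k$-spread if, for $S\sim\mu$, $\Pr_S[T\subseteq S]\le k^{-|T|}$ for every nonempty $T\subseteq U$. The support of $\mu$ is $\{S\subseteq U:\mu(S)>0\}$. VC dimension: a set $D\subseteq U$ is shattered by $\mathcal F$ if $\{S\cap D:S\in\mathcal F\}=2^D$; $\mathrm{VC}(\mathcal F)$ is the largest size of a set shattered by $\mathcal F$. *)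

(* Defs.v *)
From mathcomp Require Import all_boot all_order all_algebra.
From mathcomp Require Import reals exp.
Set Implicit Arguments.
Unset Strict Implicit.
Unset Printing Implicit Defensive.
Import Order.TTheory GRing.Theory Num.Theory.
Local Open Scope ring_scope.

(* A probability measure on a finite type is given by its mass function. *)
Definition prob_measure (R : realType) (T : finType) (mu : T -> R) : Prop :=
  (forall x, 0 <= mu x) /\ \sum_(x : T) mu x = 1.

Definition Pr (R : realType) (T : finType) (mu : T -> R) (E : pred T) : R :=
  \sum_(x | E x) mu x.

Definition support_of (R : realType) (U : finType) (mu : {set U} -> R) :
    {set {set U}} :=
  [set S | 0 < mu S].

Definition spread (R : realType) (U : finType) (k : R) (mu : {set U} -> R) :
    Prop :=
  forall T : {set U}, T != set0 ->
    Pr mu (fun S => T \subset S) <= k ^- #|T|.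

Definition shattered (U : finType) (F : {set {set U}}) (D : {set U}) : bool :=
  [set S :&: D | S in F] == powerset D.

(* An empty F shatters nothing; its VC dimension is 0 here. *)
Definition VC (U : finType) (F : {set {set U}}) : nat :=
  \max_(D : {set U} | shattered F D) #|D|.

(* Law of the random subset of U containing each point independently with
   probability p. *)
Definition Bin (R : realType) (U : finType) (p : R) (W : {set U}) : R :=
  \prod_(x : U) (if x \in W then p else 1 - p).

(* Main.v *)
Require Import Defs.
From mathcomp Require Import all_boot all_order all_algebra.
From mathcomp Require Import reals sequences exp.
From mathcomp Require Import ring lra zify.
Set Implicit Arguments.
Unset Strict Implicit.
Unset Printing Implicit Defensive.
Import Order.TTheory GRing.Theory Num.Theory.
Local Open Scope ring_scope.

(** For S in the support F and W random, let the fragment of (S, W) be the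
    smallest A \ W with A in F and A inside S u W; the theorem says that this
    fragment is empty with probability at least 1 - eps.

    Sprinkling.  Let W0 be a random thinning of W, and suppose the fragment X
    of (S, W0) has size N and that (S, W) still has no smaller fragment.  Then,
    with Z = W u X, every member of F inside Z contains X, and the intersection
    I of all these members lies in W0 u X, i.e. I survives the thinning.
    Given Z, survival costs a factor exponentially small in |I|, while X is a
    subset of a trace S n I, and by Sauer-Shelah there are only (|I| + 1)^d
    traces.  The two effects cancel independently of |I|, so the spread of mu
    makes the event exponentially unlikely in N.  Lowering N one unit at a time,
    with densities (16 / k) (1 + 1 / N)^d, brings the mean fragment size to
    O(d^2) at density O(1 / k), whatever the sizes of the members of F.

    Halving.  As long as W contains no member of F the mean fragment size is at
    least 1, and a fresh random set of density O(1 / k) halves it; this step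
    uses only the spread.  O(log ((d + 1) / eps)) such rounds bring the mean
    below eps. *)

(** * Random subsets *)

Section BinomialSubset.
Variables (R : realType) (U : finType).
Implicit Types (p q r : R) (V W X Z : {set U}).

Lemma Bin_ge0 p W : 0 <= p <= 1 -> 0 <= Bin p W.
Proof. by move=> /andP[p0 p1]; apply: prodr_ge0 => x _; case: ifP; lra. Qed.

Lemma sum_prod_set (f g : U -> R) :
  \sum_(W : {set U}) \prod_x (if x \in W then f x else g x) =
  \prod_x (f x + g x).
Proof. by rewrite bigA_distr. Qed.

Lemma sum_Bin p : \sum_(W : {set U}) Bin p W = 1.
Proof. by rewrite sum_prod_set big1 // => x _; lra. Qed.

Lemma Bin_cst p (x : R) : \sum_(W : {set U}) Bin p W * x = x.
Proof. by rewrite -mulr_suml sum_Bin mul1r. Qed.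

Lemma prod_indicator (b : U -> bool) :
  \prod_x ((b x)%:R : R) = [forall x, b x]%:R.
Proof.
case: forallP => [h|/forallP]; first by rewrite big1 // => x _; rewrite h.
rewrite negb_forall => /existsP[x bx].
by rewrite (bigD1 x) //= (negbTE bx) mul0r.
Qed.

Lemma Bin_superset p X :
  \sum_(W : {set U} | X \subset W) Bin p W = p ^+ #|X|.
Proof.
rewrite big_mkcond /= -[RHS]prodr_const [RHS]big_mkcond /=.
transitivity (\prod_x ((if x \in X then p else p) +
                       (if x \in X then 0 else 1 - p))); last first.
  by apply: eq_bigr => x _; case: ifP => _; lra.
rewrite -sum_prod_set; apply: eq_bigr => W _.
have -> : (if X \subset W then Bin p W else 0) =
    (\prod_x ((x \in X) ==> (x \in W))%:R) * Bin p W.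
  rewrite prod_indicator; case: ifPn => [/subsetP h|h].
    rewrite (_ : [forall x, _]) ?mul1r //.
    by apply/forallP => x; apply/implyP/h.
  rewrite (_ : [forall x, _] = false) ?mul0r //.
  by apply: contraNF h => /forallP h; apply/subsetP => x; apply/implyP.
rewrite -big_split /=; apply: eq_bigr => x _.
by case: (x \in X); case: (x \in W); rewrite /= ?mul1r ?mul0r.
Qed.

(** The indicator of [W :&: Y == V] is a product over points, so the double sum factorizes into
    one-point sums of four terms. *)
Lemma sum_Bin_setI p r V :
  \sum_(W : {set U}) \sum_(Y : {set U} | W :&: Y == V) Bin p W * Bin r Y =
  Bin (p * r) V.
Proof.
pose e (b : bool) (x : U) : R := (b == (x \in V))%:R.
transitivity (\prod_x (p * (r * e true x + (1 - r) * e false x) +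
   (1 - p) * (r * e false x + (1 - r) * e false x))); last first.
  by apply: eq_bigr => x _; rewrite /e; case: (x \in V) => /=; ring.
rewrite -sum_prod_set; apply: eq_bigr => W _.
transitivity (\prod_x ((if x \in W then p * (r * e true x)
                        else (1 - p) * (r * e false x)) +
    (if x \in W then p * ((1 - r) * e false x)
     else (1 - p) * ((1 - r) * e false x)))); last first.
  by apply: eq_bigr => x _; case: ifP => _; ring.
rewrite -sum_prod_set big_mkcond; apply: eq_bigr => Y _.
transitivity ((\prod_x e (x \in W :&: Y) x) * (Bin p W * Bin r Y)).
  rewrite /e prod_indicator; case: ifPn => [/eqP<-|h].
    by rewrite (_ : [forall x, _]) ?mul1r //; apply/forallP.
  rewrite (_ : [forall x, _] = false) ?mul0r //.
  by apply: contraNF h => /forallP h; apply/eqP/setP => x; apply/eqP.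
rewrite -!big_split /=; apply: eq_bigr => x _; rewrite inE.
by case: (x \in W); case: (x \in Y) => /=; ring.
Qed.

(** Thinning: from right to left, the set of density [p * r] is coupled with a superset of density
    [p]. *)
Lemma Bin_setI p r (h : {set U} -> R) :
  \sum_(W : {set U}) Bin p W * (\sum_(Y : {set U}) Bin r Y * h (W :&: Y)) =
  \sum_(V : {set U}) Bin (p * r) V * h V.
Proof.
under [RHS]eq_bigr => V _ do rewrite -sum_Bin_setI mulr_suml.
rewrite exchange_big /=; apply: eq_bigr => W _; rewrite mulr_sumr.
under [RHS]eq_bigr => V _ do rewrite mulr_suml big_mkcond.
rewrite exchange_big /=; apply: eq_bigr => Y _; rewrite -big_mkcond /=.
by rewrite (big_pred1 (W :&: Y)) ?mulrA // => V; rewrite eq_sym.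
Qed.

Lemma Bin_setC p W : Bin p (~: W) = Bin (1 - p) W.
Proof. by apply: eq_bigr => x _; rewrite inE; case: (x \in W) => /=; lra. Qed.

(** Complementation turns the union into an intersection of sets of densities [1 - p] and
    [1 - q]. *)
Lemma Bin_setU p q (h : {set U} -> R) :
  \sum_(W : {set U}) Bin p W * (\sum_(Y : {set U}) Bin q Y * h (W :|: Y)) =
  \sum_(V : {set U}) Bin (p + q - p * q) V * h V.
Proof.
rewrite (reindex_inj (inv_inj (@setCK U))) /=.
under eq_bigr => W _ do rewrite (reindex_inj (inv_inj (@setCK U))) /=.
rewrite [RHS](reindex_inj (inv_inj (@setCK U))) /=.
under eq_bigr => W _.
  rewrite Bin_setC.
  under eq_bigr => Y _ do rewrite Bin_setC -setCI.
  over.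
rewrite (Bin_setI (1 - p) (1 - q) (fun V => h (~: V))).
by apply: eq_bigr => V _; rewrite Bin_setC; congr (Bin _ _ * _); ring.
Qed.

Lemma Bin_antitone p q (h : {set U} -> R) :
  0 <= p -> p <= q -> q <= 1 -> 0 < q ->
  (forall V W, V \subset W -> h W <= h V) ->
  \sum_(W : {set U}) Bin q W * h W <= \sum_(W : {set U}) Bin p W * h W.
Proof.
move=> p0 pq q1 q0 hanti.
have -> : p = q * (p / q) by rewrite mulrC divfK ?gt_eqF.
rewrite -Bin_setI; apply: ler_sum => W _.
apply: ler_wpM2l; first by apply: Bin_ge0; lra.
rewrite -[X in X <= _](Bin_cst (p / q)).
apply: ler_sum => Y _; apply: ler_wpM2l; last by apply/hanti/subsetIl.
by apply: Bin_ge0; rewrite divr_ge0 ?(ltW q0)// ler_pdivrMr ?mul1r.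
Qed.

Lemma Bin_setD_le p X Z : 0 <= p <= 1 -> X \subset Z ->
  Bin p (Z :\: X) * p ^+ #|X| <= Bin p Z.
Proof.
move=> /andP[p0 p1] /subsetP XZ.
rewrite -prodr_const [X in _ * X]big_mkcond -big_split /=.
apply: ler_prod => x _; rewrite inE; case: (boolP (x \in X)) => [xX|_] /=.
  by rewrite (XZ _ xX); apply/andP; split; nra.
by rewrite mulr1; apply/andP; split; case: ifP; lra.
Qed.

(** The map from W to W u X is injective on sets W disjoint from X, and each point of X changes the
    weight [1 - p] to [p], where [(1 - p) * p <= p]. Both union bounds below use this to fix Z
    before summing over X and S. *)
Lemma Bin_plant p X (h : {set U} -> R) : 0 <= p <= 1 -> (forall Z, 0 <= h Z) ->
  (\sum_(W : {set U} | [disjoint X & W]) Bin p W * h (W :|: X)) * p ^+ #|X| <=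
  \sum_(Z : {set U} | X \subset Z) Bin p Z * h Z.
Proof.
move=> p01 h0.
rewrite (reindex_onto (fun Z => Z :\: X) (fun W => W :|: X)) /=; last first.
  move=> W XW; rewrite setDUl setDv setU0; apply/setDidPl.
  by rewrite disjoint_sym.
rewrite mulr_suml big_mkcond [X in _ <= X]big_mkcond /=.
apply: ler_sum => Z _; case: (boolP (X \subset Z)) => XZ; last first.
  case: ifP => // /andP[_ /eqP E]; move: XZ.
  by rewrite -E subsetUr.
have -> : (Z :\: X) :|: X = Z by rewrite setUC -{1}(setIidPr XZ) setID.
case: ifP => _; first by rewrite mulrAC ler_wpM2r // Bin_setD_le.
by rewrite mulr_ge0 // Bin_ge0.
Qed.

End BinomialSubset.

(** * Traces of families of bounded VC dimension *)

Section SauerShelah.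
Local Open Scope nat_scope.
Variable U : finType.
Implicit Types (A B D I : {set U}) (F G : {set {set U}}).

Lemma shatteredP F D :
  reflect (forall B, B \subset D -> exists2 A, A \in F & A :&: D = B)
          (shattered F D).
Proof.
apply: (iffP eqP) => [h B BD|h].
  have : B \in powerset D by rewrite powersetE.
  by rewrite -h => /imsetP[A AF ->]; exists A.
apply/setP => B; rewrite powersetE; apply/imsetP/idP => [[A _ ->]|].
  exact: subsetIr.
by move=> /h[A AF <-]; exists A.
Qed.

(** Split at a point x: after deleting x, the sets avoiding x and those containing x form two
    families whose union has dimension at most d and whose intersection has dimension at most d - 1;
    the two sizes add up to [#|G|]. *)
Lemma sauer_shelah d G I :
  G \subset powerset I ->
  (forall D, shattered G D -> #|D| <= d) ->
  #|G| <= (#|I| + 1) ^ d.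
Proof.
move En : #|I| => n.
elim: n d G I En => [|n IH] d G I En GI VCG.
  have /eqP I0 : I == set0 by rewrite -cards_eq0 En.
  rewrite add0n exp1n (leq_trans (subset_leq_card GI)) //.
  by rewrite I0 card_powerset cards0.
have /card_gt0P[x xI] : 0 < #|I| by rewrite En.
have En' : #|I :\ x| = n by move: (cardsD1 x I); rewrite xI En; lia.
pose Gn := [set A in G | x \notin A].
pose Gx := [set A in G | x \in A].
pose Gx' := [set A :\ x | A in Gx].
have cGx : #|Gx'| = #|Gx|.
  apply: card_in_imset => A B; rewrite !inE => /andP[_ xA] /andP[_ xB] E.
  by rewrite -(setD1K xA) E setD1K.
have cG : #|G| = #|Gn| + #|Gx'|.
  rewrite cGx -(cardsID [set A : {set U} | x \in A] G) addnC; congr (_ + _).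
    by apply: eq_card => A; rewrite !inE andbC.
  by apply: eq_card => A; rewrite !inE.
have sub0 (A : {set U}) : A \in Gn :|: Gx' -> exists2 C, C \in G & A = C :\ x.
  rewrite !inE => /orP[/andP[AG xA]|/imsetP[C]].
    exists A => //; apply/esym/setDidPl.
    by rewrite disjoint_sym disjoints1.
  by rewrite inE => /andP[CG _] ->; exists C.
have IH0 : #|Gn :|: Gx'| <= (n + 1) ^ d.
  apply: (IH _ _ _ En').
    apply/subsetP => A /sub0[C CG ->]; rewrite powersetE setSD //.
    by move/subsetP: GI => /(_ _ CG); rewrite powersetE.
  move=> D /shatteredP sD; apply: VCG; apply/shatteredP => B BD.
  have xD : x \notin D.
    have [A /sub0[C _ ->] E] := sD D (subxx D).
    by rewrite -E !inE eqxx.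
  have [A /sub0[C CG ->] <-] := sD B BD.
  exists C => //; rewrite setIDAC; apply/esym/setDidPl.
  by rewrite disjoint_sym disjoints1 inE negb_and xD orbT.
have subH (A : {set U}) : A \in Gn :&: Gx' -> [/\ A \in G, x \notin A & x |: A \in G].
  rewrite !inE => /andP[/andP[AG xA]] /imsetP[C].
  by rewrite inE => /andP[CG xC] EA; split => //; rewrite EA setD1K.
rewrite cG -cardsUI.
(* For d = 0 the intersection is empty: [A] and [x |: A] both in [G] would shatter [[set x]]. *)
case: d VCG IH0 => [|d] VCG IH0.
  have -> : Gn :&: Gx' = set0.
    apply/setP => A; rewrite [RHS]inE; apply/negbTE/negP => /subH[AG xA xAG].
    suff /VCG : shattered G [set x] by rewrite cards1.
    apply/shatteredP => B; rewrite subset1 => /orP[/eqP->|/eqP->].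
      by exists (x |: A) => //; apply/setIidPr; rewrite sub1set setU11.
    exists A => //; apply/disjoint_setI0.
    by rewrite disjoint_sym disjoints1.
  by rewrite cards0 addn0; move: IH0; rewrite !expn0.
(* Each member of the intersection lies in [G] both with and without x, so a set it shatters stays
   shattered by [G] after x is added. *)
have IH1 : #|Gn :&: Gx'| <= (n + 1) ^ d.
  apply: (IH _ _ _ En').
    apply/subsetP => A /subH[AG xA _]; rewrite powersetE subsetD1 xA andbT.
    by move/subsetP: GI => /(_ _ AG); rewrite powersetE.
  move=> D /shatteredP sD.
  have xD : x \notin D.
    have [A /subH[_ xA _] E] := sD D (subxx D).
    by rewrite -E inE (negbTE xA).
  suff /VCG : shattered G (x |: D) by rewrite cardsU1 xD.
  apply/shatteredP => B BD.
  have BD' : B :\ x \subset D.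
    by apply/subsetP => y; rewrite !inE => /andP[yx] /(subsetP BD);
      rewrite !inE (negbTE yx).
  have [A /subH[AG xA xAG] E] := sD _ BD'.
  case: (boolP (x \in B)) => xB.
    by exists (x |: A) => //; rewrite -setUIr E setD1K.
  exists A => //; rewrite setIUr E (disjoint_setI0 _) ?set0U.
    by apply/setDidPl; rewrite disjoint_sym disjoints1.
  by rewrite disjoint_sym disjoints1.
rewrite (leq_trans (leq_add IH0 IH1)) // !expnS addn1.
rewrite -mulSnr; apply: leq_mul; first by lia.
by case: (d) => // e; rewrite leq_exp2r // !addn1.
Qed.

Lemma traces_le d F I :
  VC F <= d -> #|[set S :&: I | S in F]| <= (#|I| + 1) ^ d.
Proof.
move=> VCF; apply: sauer_shelah.
  by apply/subsetP => A /imsetP[S _ ->]; rewrite powersetE subsetIr.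
move=> D /shatteredP sD; apply: leq_trans VCF.
apply: leq_bigmax_cond; apply/shatteredP => B BD.
have DI : D \subset I.
  have [A /imsetP[S _ ->] <-] := sD D (subxx D).
  by rewrite -setIA subIset // subsetIl orbT.
have [A /imsetP[S SF ->] <-] := sD B BD.
by exists S => //; rewrite -setIA (setIidPr DI).
Qed.
End SauerShelah.

(** * Fragments and sprinkling *)

Section Fragments.
Variables (U : finType) (F : {set {set U}}).
Implicit Types (A S W X Z : {set U}).

Definition best S W : {set U} :=
  [arg min_(A < S | (A \in F) && (A \subset S :|: W)) #|A :\: W|]%N.

Definition frag S W : {set U} := best S W :\: W.

(** The set I of the sprinkling argument; it is all of U when [Z] contains no member of [F]. *)
Definition core Z : {set U} := \bigcap_(A in F | A \subset Z) A.

Lemma bestP S W : S \in F -> [/\ best S W \in F, best S W \subset S :|: W &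
  forall A, A \in F -> A \subset S :|: W -> (#|frag S W| <= #|A :\: W|)%N].
Proof.
move=> SF; rewrite /frag /best; case: arg_minnP => [|A /andP[AF AS] h].
  by rewrite SF subsetUl.
by split=> // B BF BS; apply: h; rewrite BF.
Qed.

Lemma frag_sub S W : S \in F -> frag S W \subset S.
Proof. by move=> SF; have [_ h _] := bestP W SF; rewrite subDset setUC. Qed.

Lemma best_sub S W : S \in F -> best S W \subset W :|: frag S W.
Proof. by move=> SF; rewrite -subDset. Qed.

Lemma frag_le S W A : S \in F -> A \in F -> A \subset S :|: W ->
  (#|frag S W| <= #|A :\: W|)%N.
Proof. by move=> SF; have [_ _] := bestP W SF; apply. Qed.

Lemma frag_antitone S W W' : S \in F -> W \subset W' ->
  (#|frag S W'| <= #|frag S W|)%N.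
Proof.
move=> SF WW'; have [bF bS _] := bestP W SF.
apply: leq_trans (frag_le SF bF _) _; last by apply/subset_leq_card/setDS.
by rewrite (subset_trans bS) // setUS.
Qed.

Lemma frag_hit S W A : S \in F -> A \in F -> A \subset W -> #|frag S W| = 0%N.
Proof.
move=> SF AF AW; apply/eqP; rewrite -leqn0.
apply: leq_trans (frag_le SF AF _) _; first by rewrite (subset_trans AW) ?subsetUr.
by rewrite leqn0 cards_eq0 setD_eq0.
Qed.

(** A member A of [F] inside W u X lies in S u W and has A \ W inside X; minimality at W and
    equality of the sizes force A \ W = X. One such A, [best S W0], lies in W0 u X, which confines
    the core. *)
Lemma frag_stuck S W0 W (X := frag S W0) : S \in F -> W0 \subset W ->
  #|frag S W0| = #|frag S W| ->
  [/\ [disjoint X & W], X \subset core (W :|: X) &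
      core (W :|: X) \subset W0 :|: X].
Proof.
move=> SF W0W E.
have [bF bS _] := bestP W0 SF.
have bX : best S W0 \subset W0 :|: X by apply: best_sub.
have bWX : best S W0 \subset W :|: X by rewrite (subset_trans bX) ?setSU.
have eqX A : A \in F -> A \subset W :|: X -> A :\: W = X.
  move=> AF AWX; apply/eqP; rewrite eqEcard subDset AWX /= /X E.
  apply: frag_le => //; rewrite (subset_trans AWX) // setUC setSU //.
  exact: frag_sub.
split.
- by rewrite -(eqX _ bF bWX) disjoint_sym disjoints_subset setDE setCI setCK subsetUr.
- apply/bigcapsP => A /andP[AF AWX].
  by rewrite -(eqX _ AF AWX) subsetDl.
- by apply: subset_trans bX; apply: bigcap_inf; rewrite bF.
Qed.

End Fragments.

Section Sprinkling.
Variables (R : realType) (U : finType) (k : R) (mu : {set U} -> R) (d : nat).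
Hypotheses (mu_prob : prob_measure mu) (mu_spread : spread k mu).
Local Notation F := (support_of mu).

Lemma mu_ge0 S : 0 <= mu S. Proof. by case: mu_prob. Qed.

Lemma sum_mu : \sum_S mu S = 1. Proof. by case: mu_prob. Qed.

Lemma mu_out S : S \notin F -> mu S = 0.
Proof. by rewrite inE -leNgt => h; apply/le_anti; rewrite h mu_ge0. Qed.

Lemma sum_mu_le (f g : {set U} -> R) :
  (forall S, S \in F -> f S <= g S) ->
  \sum_S mu S * f S <= \sum_S mu S * g S.
Proof.
move=> fg; apply: ler_sum => S _; case: (boolP (S \in F)) => SF.
  by rewrite ler_wpM2l ?mu_ge0 ?fg.
by rewrite mu_out // !mul0r.
Qed.

Hypotheses (k2 : 2 <= k) (VCd : (VC F <= d)%N).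

(** Group the S by their trace A on I. Spread gives A mass at most k^-|A|, A has at most 2^|A|
    subsets, and (2/k)^|A| <= (2/k)^N when |A| >= N; Sauer-Shelah counts the traces. *)
Lemma trace_count (I : {set U}) (N : nat) : (0 < N)%N ->
  \sum_S mu S * #|[set X : {set U} | (X \subset S :&: I) && (#|X| == N)]|%:R
  <= ((#|I| + 1) ^ d)%:R * (2 / k) ^+ N.
Proof.
move=> N0; pose G := [set S :&: I | S in F].
have k0 : 0 < k by apply: lt_le_trans k2; rewrite ltr0n.
have c0 : 0 <= 2 / k by rewrite divr_ge0 // ltW.
have cN0 : 0 <= (2 / k) ^+ N by rewrite exprn_ge0.
have cX (A : {set U}) :
    #|[set X : {set U} | (X \subset A) && (#|X| == N)]| = 'C(#|A|, N).
  by rewrite -cards_draws; apply: eq_card => X; rewrite !inE.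
under eq_bigr => S _ do rewrite cX.
rewrite (bigID (mem F)) /= [X in _ + X]big1 ?addr0; last first.
  by move=> S SF; rewrite mu_out ?mul0r.
rewrite (partition_big (fun S => S :&: I) (mem G)) /=; last first.
  by move=> S SF; apply/imsetP; exists S.
apply: (@le_trans _ _ (\sum_(A in G) (2 / k) ^+ N)); last first.
  rewrite sumr_const -[X in X <= _]mulr_natl ler_wpM2r //.
  by rewrite ler_nat traces_le.
apply: ler_sum => A AG.
have [NA|AN] := leqP N #|A|; last first.
  rewrite big1 // => S /andP[_ /eqP->].
  by rewrite bin_small // mulr0.
have A0 : A != set0 by rewrite -card_gt0 (leq_trans N0).
under eq_bigr => S /andP[_ /eqP->] do [].
rewrite -mulr_suml.
have h1 : \sum_(S in F | S :&: I == A) mu S <= k ^- #|A|.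
  apply: le_trans (mu_spread A0); rewrite /Pr big_mkcond [X in _ <= X]big_mkcond.
  apply: ler_sum => S _; case: ifP => [/andP[_ /eqP<-]|_].
    by rewrite subsetIl.
  by case: ifP; rewrite ?mu_ge0.
have h2 : ('C(#|A|, N))%:R <= (2 ^+ #|A| : R).
  rewrite -natrX ler_nat -card_powerset -cX; apply: subset_leq_card.
  by apply/subsetP => X; rewrite !inE => /andP[].
apply: le_trans (ler_pM _ _ h1 h2) _ => //.
  by apply: sumr_ge0 => S _; apply: mu_ge0.
rewrite -exprVn mulrC -exprMn.
by apply: ler_wiXn2l NA; rewrite // ler_pdivrMr ?mul1r.
Qed.

(** The number of traces cancels against the survival factor, uniformly in m: take d-th powers in
    [th * (m + 1) <= 1 + m * th <= (1 + th) ^ m]. *)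
Lemma exp_poly_le (th : R) (m : nat) : 0 < th <= 1 ->
  ((m + 1) ^ d)%:R * ((1 + th) ^- d) ^+ m <= th ^- d.
Proof.
move=> /andP[th0 th1].
have b : 1 + m%:R * th <= (1 + th) ^+ m.
  elim: m => [|m IH]; first by rewrite mul0r addr0 expr0.
  rewrite exprS -natr1; have m0 : (0 : R) <= m%:R by [].
  nra.
rewrite natrX -!exprVn -exprM mulnC exprM -exprMn.
have p0 : 0 < (1 + th) ^+ m by rewrite exprn_gt0 //; lra.
apply: lerXn2r; rewrite ?nnegrE.
- by rewrite mulr_ge0 // exprn_ge0 // invr_ge0; lra.
- by rewrite invr_ge0 ltW.
- rewrite exprVn ler_pdivrMr // ler_pdivlMl // mulrC natrD.
  have m0 : (0 : R) <= m%:R by [].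
  nra.
Qed.

(** Union bound over the value X of the stuck fragment: [frag_stuck] makes the core survive,
    planting X fixes Z, and for each Z the trace count meets the survival factor. *)
Lemma sprinkle_step (p th : R) (N : nat) (r := (1 + th) ^- d) :
  0 < p <= 1 -> 0 < th <= 1 -> (0 < N)%N ->
  \sum_S mu S * (\sum_(W : {set U}) Bin p W * (\sum_(Y : {set U}) Bin r Y *
    ((#|frag F S (W :&: Y)| == N) && (#|frag F S W| == N))%:R))
  <= th ^- d * (2 / (p * r * k)) ^+ N.
Proof.
move=> /andP[p0 p1] th01 N0.
have [th0 th1] := andP th01.
have k0 : 0 < k by apply: lt_le_trans k2; rewrite ltr0n.
have q1 : 1 <= (1 + th) ^+ d by apply: exprn_ege1; lra.
have r0 : 0 < r by rewrite invr_gt0; lra.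
have r1 : r <= 1 by rewrite invf_le1 //; lra.
have B0 (W : {set U}) : 0 <= Bin p W by apply: Bin_ge0; lra.
have B0r (W : {set U}) : 0 <= Bin r W by apply: Bin_ge0; lra.
(* Probability that a thinning of density [r] keeps the part of the core outside X, counted only if
   X lies in the core. *)
pose phi (X Z : {set U}) : R :=
  (X \subset core F Z)%:R * r ^+ #|core F Z :\: X|.
have phi0 X Z : 0 <= phi X Z by rewrite mulr_ge0 // exprn_ge0 // ltW.
pose P (S X : {set U}) := (X \subset S) && (#|X| == N).
apply: (@le_trans _ _ (\sum_S mu S * (\sum_(X | P S X)
   \sum_(W : {set U} | [disjoint X & W]) Bin p W * phi X (W :|: X)))).
  apply: sum_mu_le => S SF.
  pose ind (X W Y : {set U}) : bool := [&& [disjoint X & W],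
    X \subset core F (W :|: X) & core F (W :|: X) :\: X \subset Y].
  apply: (@le_trans _ _ (\sum_(W : {set U}) Bin p W *
     \sum_(Y : {set U}) Bin r Y * \sum_(X | P S X) (ind X W Y)%:R)).
    apply: ler_sum => W _; apply: ler_wpM2l => //.
    apply: ler_sum => Y _; apply: ler_wpM2l => //.
    case: (boolP (_ && _)) => [/andP[/eqP E1 /eqP E2]|_]; last exact: sumr_ge0.
    set X := frag F S (W :&: Y).
    have [|h1 h2 h3] := @frag_stuck U F S (W :&: Y) W SF (subsetIl _ _).
      by rewrite E1 E2.
    have PX : P S X by rewrite /P /X E1 eqxx frag_sub.
    rewrite (bigD1 X) //= (_ : ind X W Y) ?lerDl ?sumr_ge0 //.
    apply/and3P; split=> //; rewrite subDset (subset_trans h3) //.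
    by rewrite setUC setUS // subsetIr.
  under eq_bigr => W _.
    under eq_bigr => Y _ do rewrite mulr_sumr.
    rewrite exchange_big mulr_sumr /=.
    over.
  rewrite exchange_big /=; apply: ler_sum => X PX.
  rewrite [X in _ <= X]big_mkcond /=; apply: ler_sum => W _.
  rewrite /ind /phi; case: ifP => dXW; last first.
    by rewrite big1 ?mulr0 // => Y _; rewrite mulr0.
  apply: ler_wpM2l => //; case: (X \subset _) => /=; last first.
    by rewrite big1 ?mul0r // => Y _; rewrite mulr0.
  rewrite mul1r -(Bin_superset r) [X in _ <= X]big_mkcond /=.
  by apply: ler_sum => Y _; case: ifP; rewrite ?mulr1 ?mulr0.
apply: (@le_trans _ _ (\sum_S mu S * (\sum_(X | P S X)
   p ^- N * \sum_(Z : {set U}) Bin p Z * phi X Z))).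
  apply: sum_mu_le => S SF; apply: ler_sum => X /andP[_ /eqP XN].
  rewrite ler_pdivlMl ?exprn_gt0 // mulrC -XN.
  apply: le_trans (@Bin_plant _ _ p X (phi X) _ _) _ => //; first by lra.
  rewrite big_mkcond /=; apply: ler_sum => Z _; case: ifP => // _.
  by rewrite mulr_ge0.
(* The bound is written as a mean over Z, so that Z can be fixed. *)
apply: (@le_trans _ _ (\sum_(Z : {set U})
   Bin p Z * (th ^- d * (2 / (p * r * k)) ^+ N))); last first.
  by rewrite Bin_cst.
under eq_bigr => S _.
  rewrite -mulr_sumr exchange_big /= mulr_sumr mulr_sumr.
  over.
rewrite exchange_big /=; apply: ler_sum => Z _.
under eq_bigr => S _ do rewrite -mulr_sumr !mulrA [_ * Bin p Z]mulrC -!mulrA.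
rewrite -mulr_sumr ler_wpM2l //.
set c := core F Z.
(* X takes N points of the core, so only [#|c| - N] have to survive; hence the [r ^- N]. *)
apply: (@le_trans _ _ ((p * r) ^- N * r ^+ #|c| * \sum_S mu S *
   #|[set X : {set U} | (X \subset S :&: c) && (#|X| == N)]|%:R)).
  rewrite mulr_sumr; apply: ler_sum => S _.
  rewrite [X in _ <= X]mulrCA; apply: ler_wpM2l; first exact: mu_ge0.
  rewrite -(sum1_card (mem [set X : {set U} | (X \subset S :&: c) && (#|X| == N)])).
  rewrite natr_sum !mulr_sumr.
  rewrite big_mkcond [X in _ <= X]big_mkcond /=.
  apply: ler_sum => X _; rewrite inE subsetI /P /phi -/c.
  case: (X \subset S) => //=; case: eqP => XN /=; last by rewrite andbF.
  rewrite andbT; case: (boolP (X \subset c)) => Xc; last by rewrite mul0r mulr0.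
  rewrite mul1r mulr1 cardsD (setIidPr Xc) XN exprMn invfM -mulrA.
  rewrite ler_pM2l ?invr_gt0 ?exprn_gt0 //.
  rewrite -{2}(@subnKC N #|c|) ?exprD ?mulKf ?gt_eqF ?exprn_gt0 //.
  by rewrite -XN subset_leq_card.
apply: (@le_trans _ _ ((p * r) ^- N * r ^+ #|c| *
    (((#|c| + 1) ^ d)%:R * (2 / k) ^+ N))).
  by rewrite ler_wpM2l ?trace_count // mulr_ge0 ?invr_ge0 ?exprn_ge0 ?mulr_ge0 ?ltW.
have -> : (2 / (p * r * k)) ^+ N = (p * r) ^- N * (2 / k) ^+ N.
  by rewrite -exprVn -exprMn invfM mulrCA.
have swap (x y z t : R) : x * y * (z * t) = x * t * (z * y) by ring.
rewrite swap.
rewrite [X in _ <= X]mulrC; apply: ler_wpM2l; last exact: exp_poly_le.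
apply: mulr_ge0; last by rewrite exprn_ge0 // divr_ge0 // ltW.
by rewrite invr_ge0 exprn_ge0 // mulr_ge0 // ltW.
Qed.

End Sprinkling.

(** * Numerical estimates for the sprinkling densities *)

(** Bounds by [2 ^ N] the cost [th ^- d] of one sprinkling. With s the integer square root of N,
    [N + 1 <= 2 ^ (2 * s)], while [4 * d <= s] gives [4 * s * d <= N]. *)
Lemma exp_ge_poly (d N : nat) : (16 * d ^ 2 <= N)%N ->
  ((N * (N + 2)) ^ d <= 2 ^ N)%N.
Proof.
move=> dN.
have [s /andP[sN Ns]] : exists s, (s * s <= N < s.+1 * s.+1)%N.
  elim: N {dN} => [|N [s /andP[h1 h2]]]; first by exists 0%N.
  have [e|e] := leqP (s.+1 * s.+1) N.+1; last by exists s; lia.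
  by exists s.+1; nia.
have ds : (4 * d <= s)%N by rewrite -ltnS; nia.
have s2 : (s.+1 <= 2 ^ s)%N by apply: ltn_expl.
have b : (N * (N + 2) <= 2 ^ (4 * s))%N.
  have -> : (2 ^ (4 * s) = (2 ^ s * 2 ^ s) * (2 ^ s * 2 ^ s))%N.
    by rewrite -!expnD; congr (2 ^ _)%N; lia.
  have h : (N.+1 <= 2 ^ s * 2 ^ s)%N by apply: leq_trans Ns _; apply: leq_mul.
  by apply: leq_trans (leq_mul h h); nia.
apply: (@leq_trans ((2 ^ (4 * s)) ^ d)%N).
  by case: (d) => // e; rewrite leq_exp2r.
by rewrite -expnM leq_exp2l //; nia.
Qed.

Lemma expR1_le4 (R : realType) : expR (1 : R) <= 4.
Proof.
have h : expR (- (1 / 2)) >= (1 / 2 : R).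
  by apply: le_trans (expR_ge1Dx _); lra.
have e : expR (1 : R) * (expR (- (1 / 2)) * expR (- (1 / 2))) = 1.
  rewrite -!expRD (_ : 1 + _ = 0) ?expR0 //; lra.
have e0 := expR_gt0 (1 : R).
have h2 : 1 / 4 <= expR (- (1 / 2)) * expR (- (1 / 2)) :> R by nra.
nra.
Qed.

Lemma exp_invn_le4 (R : realType) (d N : nat) : (d <= N)%N -> (0 < N)%N ->
  (1 + N%:R^-1) ^+ d <= (4 : R).
Proof.
move=> dN N0; apply: le_trans (expR1_le4 R).
have N0' : (0 : R) < N%:R by rewrite ltr0n.
apply: (@le_trans _ _ (expR (N%:R^-1) ^+ d)).
  apply: lerXn2r; rewrite ?nnegrE ?expR_ge0 ?addr_ge0 ?invr_ge0 //.
  exact: expR_ge1Dx.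
by rewrite -expRM_natl ler_expR ler_pdivrMr // mul1r ler_nat.
Qed.

(** In use, [a] is the fragment size for W and [b] that for a thinning of W. *)
Lemma stuck_or_shrink (a b N : nat) : (a <= b)%N ->
  ((N <= a) <= (N < b) + ((b == N) && (a == N)))%N.
Proof.
case: (leqP N a) => // Na ab; case: ltngtP (leq_trans Na ab) => // bN _.
by rewrite (_ : a == N) // eqn_leq Na bN ab.
Qed.

(** * Mean fragment size at density O(1 / k) *)

Section LargeFragments.
Variables (R : realType) (U : finType) (k : R) (mu : {set U} -> R) (d : nat).
Local Notation F := (support_of mu).
Hypotheses (mu_prob : prob_measure mu) (mu_spread : spread k mu).
Hypotheses (k64 : 64 <= k) (VCd : (VC F <= d)%N) (d1 : (1 <= d)%N).

Let sum_mu_le := sum_mu_le mu_prob.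
Let mu_ge0 := mu_ge0 mu_prob.

Definition tail (p : R) (N : nat) : R :=
  \sum_S mu S * \sum_(W : {set U}) Bin p W * (N <= #|frag F S W|)%N%:R.

(** For N >= d >= 1 it lies between [16 / k], which makes the sprinkling errors summable, and
    [64 / k]. *)
Definition density (N : nat) : R := 16 / k * (1 + N%:R^-1) ^+ d.

Let k_gt0 : 0 < k. Proof. by apply: lt_le_trans k64; rewrite ltr0n. Qed.

Lemma density_bounds N : (d <= N)%N -> 16 / k <= density N <= 64 / k.
Proof.
move=> dN; have N0 : (0 < N)%N by apply: leq_trans dN.
have k0 := k_gt0; rewrite /density; apply/andP; split.
  rewrite -[X in X <= _]mulr1 ler_wpM2l ?divr_ge0 ?(ltW k0) //.
  by rewrite exprn_ege1 // lerDl invr_ge0.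
have := exp_invn_le4 R dN N0.
rewrite mulrAC ler_pM2r ?invr_gt0 //; lra.
Qed.

Lemma density_gt0 N : (d <= N)%N -> 0 < density N.
Proof.
by move=> /density_bounds/andP[h _]; apply: lt_le_trans h; rewrite divr_gt0 ?k_gt0.
Qed.

Lemma density_le1 N : (d <= N)%N -> density N <= 1.
Proof.
move=> /density_bounds/andP[_ h]; apply: le_trans h _.
by rewrite ler_pdivrMr ?k_gt0 ?mul1r.
Qed.

Lemma density_antitone M N : (d <= M)%N -> (M <= N)%N -> density N <= density M.
Proof.
move=> dM MN; have M0 : (0 < M)%N by apply: leq_trans dM.
rewrite ler_wpM2l ?divr_ge0 ?(ltW k_gt0) //.
apply: lerXn2r; rewrite ?nnegrE ?addr_ge0 ?invr_ge0 // lerD2l.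
by rewrite lef_pV2 ?posrE ?ltr0n ?ler_nat // (leq_trans M0).
Qed.

(** As [N * (N + 2) + 1 = (N + 1) ^ 2], consecutive densities differ by exactly a thinning of the
    kind in [sprinkle_step]. *)
Lemma densityS N (th : R := (N * (N + 2))%:R^-1) : (0 < N)%N ->
  density N * (1 + th) ^- d = density N.+1.
Proof.
move=> N0; rewrite /density -(mulrA (16 / k)) -exprVn -exprMn; congr (_ * _ ^+ _).
have N0' : (0 : R) < N%:R by rewrite ltr0n.
rewrite /th natrM natrD -natr1; field.
by rewrite !gt_eqF //; nra.
Qed.

Lemma tail_antitone p q N : 0 <= p -> p <= q -> q <= 1 -> 0 < q ->
  tail q N <= tail p N.
Proof.
move=> p0 pq q1 q0; apply: sum_mu_le => S SF; apply: Bin_antitone => // V W VW.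
rewrite ler_nat; case: (leqP N #|frag F S W|) => // h.
by rewrite (leq_trans h) // frag_antitone.
Qed.

(** A fragment of size at least N either exceeds N after the thinning or is stuck at N. The stuck
    case costs [2 ^ N], from [exp_ge_poly], times [(1 / 8) ^ N], since the new density is at least
    [16 / k]. *)
Lemma tail_step N : (16 * d ^ 2 <= N)%N ->
  tail (density N) N <= tail (density N.+1) N.+1 + 4 ^- N.
Proof.
move=> DN.
have dN : (d <= N)%N by nia.
have N0 : (0 < N)%N by apply: leq_trans dN.
have N0' : (0 : R) < N%:R by rewrite ltr0n.
have k0 := k_gt0.
pose th : R := (N * (N + 2))%:R^-1; pose r := (1 + th) ^- d.
have NN : (1 : R) <= (N * (N + 2))%:R by rewrite ler1n; nia.
have th01 : 0 < th <= 1.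
  by rewrite invr_gt0 (lt_le_trans _ NN) //= invf_le1 // (lt_le_trans _ NN).
have p01 : 0 < density N <= 1 by rewrite density_gt0 ?density_le1.
have q1 : 1 <= (1 + th) ^+ d by apply: exprn_ege1; lra.
have r01 : 0 <= r <= 1.
  by rewrite invr_ge0 (le_trans _ q1) //= invf_le1 // (lt_le_trans _ q1).
have ppr : density N * r = density N.+1 by apply: densityS.
have k2 : 2 <= k by apply: le_trans k64; rewrite ler_nat.
have B0 p (W : {set U}) : 0 <= p <= 1 -> 0 <= Bin p W by apply: Bin_ge0.
have pp01 : 0 <= density N <= 1 by case/andP: p01 => /ltW -> ->.
apply: (@le_trans _ _ (\sum_S mu S *
    ((\sum_(W : {set U}) Bin (density N.+1) W * (N.+1 <= #|frag F S W|)%N%:R) +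
     \sum_(W : {set U}) Bin (density N) W * (\sum_(Y : {set U}) Bin r Y *
    ((#|frag F S (W :&: Y)| == N) && (#|frag F S W| == N))%:R)))).
  apply: sum_mu_le => S SF.
  rewrite -ppr -(Bin_setI (density N) r) -big_split /=.
  apply: ler_sum => W _; rewrite -mulrDr ler_wpM2l ?B0 //.
  rewrite -big_split /= -[X in X <= _](Bin_cst U r).
  apply: ler_sum => Y _; rewrite -mulrDr ler_wpM2l ?B0 //.
  have h := @frag_antitone U F S _ W SF (subsetIl W Y).
  by rewrite -natrD ler_nat stuck_or_shrink.
under eq_bigr => S _ do rewrite mulrDr.
rewrite big_split /= lerD2l.
have := sprinkle_step mu_prob mu_spread k2 VCd p01 th01 N0.
rewrite -/r ppr => /le_trans; apply.
have kp : 16 <= density N.+1 * k.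
  rewrite -ler_pdivrMr //.
  by case/andP: (@density_bounds N.+1 (leqW dN)).
apply: (@le_trans _ _ (2 ^+ N * (1 / 8) ^+ N)); last first.
  by rewrite -exprMn -exprVn (_ : 2 * (1 / 8) = 4^-1) //; lra.
apply: ler_pM.
- by rewrite -exprVn exprn_ge0 // !invr_ge0 ?ler0n.
- by rewrite exprn_ge0 // divr_ge0 // (le_trans _ kp).
- by rewrite -exprVn invrK -!natrX ler_nat exp_ge_poly.
- have kp0 : 0 < density N.+1 * k by rewrite (lt_le_trans _ kp).
  apply: lerXn2r; rewrite ?nnegrE ?divr_ge0 ?(ltW kp0) //.
  by rewrite ler_pdivrMr //; lra.
Qed.

(** Downward induction from N > |U|, where the tail is 0; the errors form a geometric series. *)
Lemma tail_le N : (16 * d ^ 2 <= N)%N -> tail (density N) N <= 2 * 4 ^- N.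
Proof.
move En : (#|U|.+1 - N)%N => n; elim: n N En => [|n IH] N En DN.
  rewrite /tail big1 ?mulr_ge0 ?invr_ge0 ?exprn_ge0 // => S _.
  rewrite big1 ?mulr0 // => W _; rewrite leqNgt (_ : (_ < N)%N) ?mulr0 //.
  by apply: (@leq_ltn_trans #|U|); [exact: max_card | lia].
apply: le_trans (tail_step DN) _.
have := IH N.+1 _ (leqW DN); rewrite exprS invfM => /(_ ltac:(lia)) h.
have : (0 : R) <= 4 ^- N by rewrite invr_ge0 exprn_ge0.
lra.
Qed.

Lemma sum_quarter (D n : nat) : \sum_(D.+1 <= N < n) 2 * (4 : R) ^- N <= 1.
Proof.
have [nD|Dn] := leqP n D.+1; first by rewrite big_geq.
(* Strengthened so that the induction closes: the slack [3 * 4 ^- n] pays for the next term. *)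
suff : \sum_(D.+1 <= N < n) 2 * (4 : R) ^- N <= 1 - 3 * 4 ^- n.
  have : (0 : R) <= 4 ^- n by rewrite invr_ge0 exprn_ge0.
  lra.
elim: n {Dn} (ltnW Dn) => // n IH; rewrite leq_eqVlt => /predU1P[<-|Dn].
  rewrite big_geq // exprS invfM.
  have : (4 : R) ^- D <= 1 by rewrite invf_le1 ?exprn_gt0 // exprn_ege1 // ler1n.
  lra.
rewrite big_nat_recr //=; have := IH Dn; rewrite [in X in _ -> X]exprS invfM.
have : (0 : R) <= 4 ^- n by rewrite invr_ge0 exprn_ge0.
lra.
Qed.

(** The size is at most D plus the number of N > D that it reaches, and each tail at [density D] is
    at most the tail at the lower [density N]. *)
Lemma expected_frag_le (D := (16 * d ^ 2)%N) :
  \sum_S mu S * (\sum_(W : {set U}) Bin (density D) W * #|frag F S W|%:R)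
  <= D%:R + 1.
Proof.
have dD : (d <= D)%N by rewrite /D; nia.
have D0 := density_gt0 dD; have D1 := density_le1 dD.
have B01 : 0 <= density D <= 1 by rewrite ltW.
apply: (@le_trans _ _ (\sum_S mu S * (D%:R + \sum_(D.+1 <= N < #|U|.+1)
   \sum_(W : {set U}) Bin (density D) W * (N <= #|frag F S W|)%N%:R))).
  apply: sum_mu_le => S SF; rewrite exchange_big /=.
  rewrite -[X in _ <= X + _](Bin_cst U (density D)).
  rewrite -big_split /=; apply: ler_sum => W _.
  rewrite -mulr_sumr -mulrDr ler_wpM2l ?Bin_ge0 // -natr_sum -natrD ler_nat.
  have : (#|frag F S W| <= #|U|)%N by apply: max_card.
  move: #|frag F S W| #|U| => a n an.
  have [aD|Da] := leqP a D; first by apply: leq_trans (leq_addr _ _).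
  rewrite (@big_cat_nat _ _ _ a.+1) ?ltnS //=; last exact: ltnW.
  apply: leq_trans (leq_add (leqnn _) (leq_addr _ _)).
  rewrite (eq_big_nat _ _ (F2 := fun=> 1%N)) => [|i /andP[_]].
    by rewrite sum_nat_const_nat; lia.
  by rewrite ltnS => ->.
under eq_bigr => S _ do rewrite mulrDr mulr_sumr.
rewrite big_split /= -mulr_suml (sum_mu mu_prob) mul1r lerD2l exchange_big /=.
apply: le_trans (sum_quarter D #|U|.+1).
rewrite big_nat_cond [X in _ <= X]big_nat_cond; apply: ler_sum => N.
rewrite andbT => /andP[DN _]; apply: le_trans (tail_le (ltnW DN)).
have dN := leq_trans dD (ltnW DN).
by apply: tail_antitone; rewrite ?density_antitone ?(ltW (density_gt0 dN)) ?(ltnW DN).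
Qed.

End LargeFragments.

(** * Halving *)

(** The choice depends on Z alone, so once Z is fixed X ranges over subsets of the single set
    [tau (c Z)]. *)
Lemma smallest_below (U : finType) (F : {set {set U}})
    (tau : {set U} -> {set U}) :
  exists c : {set U} -> {set U}, forall Z A : {set U}, A \in F -> tau A \subset Z ->
    [/\ c Z \in F, tau (c Z) \subset Z & (#|tau (c Z)| <= #|tau A|)%N].
Proof.
pose b (Z : {set U}) := odflt set0 [pick B in F | tau B \subset Z].
exists (fun Z : {set U} =>
  [arg min_(B < b Z | (B \in F) && (tau B \subset Z)) #|tau B|]%N) => Z A AF AZ.
case: arg_minnP => [|B /andP[BF BZ] h].
  rewrite /b; case: pickP => [B //|/(_ A)]; by rewrite /= AF AZ.
by split=> //; apply: h; rewrite AF.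
Qed.

Section Halving.
Variables (R : realType) (U : finType) (k : R) (mu : {set U} -> R).
Local Notation F := (support_of mu).
Hypotheses (mu_prob : prob_measure mu) (mu_spread : spread k mu).
Hypothesis (k0 : 0 < k).

Let sum_mu_le := sum_mu_le mu_prob.
Let mu_ge0 := mu_ge0 mu_prob.

(** In the application [tau S] is the fragment of S at the set exposed so far. *)
Variable tau : {set U} -> {set U}.
Hypothesis tau_sub : forall S, S \in F -> tau S \subset S.

(* Ties for the smallest [tau A] inside [tau S :|: W] are broken by
   [#|tau A :\: W|], so that [X] is contained in the smallest member
   of the family inside [W :|: X]. *)
Lemma fragment_choice (c : {set U} -> {set U}) (S W : {set U}) :
  (forall Z A : {set U}, A \in F -> tau A \subset Z ->
    [/\ c Z \in F, tau (c Z) \subset Z & (#|tau (c Z)| <= #|tau A|)%N]) ->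
  S \in F ->
  exists A, let X := tau A :\: W in
    [/\ A \in F, tau A \subset tau S :|: W, X \subset tau (c (W :|: X))
      & (#|tau (c (W :|: X))| <= #|tau S|)%N].
Proof.
move=> cP SF.
pose w A := (#|tau A| * #|U|.+1 + #|tau A :\: W|)%N.
pose A := [arg min_(A < S | (A \in F) && (tau A \subset tau S :|: W)) w A]%N.
have [AF AS Amin] : [/\ A \in F, tau A \subset tau S :|: W &
    forall B, B \in F -> tau B \subset tau S :|: W -> (w A <= w B)%N].
  rewrite /A; case: arg_minnP => [|B /andP[BF BS] h].
    by rewrite SF subsetUl.
  by split=> // B' B'F B'S; apply: h; rewrite B'F.
exists A => X; set Z := W :|: X.
have AZ : tau A \subset Z by rewrite -subDset.
have XS : X \subset tau S by rewrite subDset setUC.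
have [cF cZ cA] := cP Z A AF AZ.
have cS : tau (c Z) \subset tau S :|: W.
  by rewrite (subset_trans cZ) // /Z setUC setSU.
have wU (B : {set U}) : (#|B| < #|U|.+1)%N by rewrite ltnS max_card.
have h1 := Amin _ cF cS.
have h2 := Amin _ SF (subsetUl _ _).
have XU := wU (tau A :\: W); have cU := wU (tau (c Z) :\: W).
have SU := wU (tau S :\: W).
split=> //; last by apply: leq_trans cA _; rewrite /w in h2; nia.
(* [c Z] competes with A and its part outside W lies in X, so minimality of A gives equality. *)
have <- : tau (c Z) :\: W = X by
  apply/eqP; rewrite eqEcard subDset cZ /=; rewrite /w in h1; rewrite /X; nia.
exact: subsetDl.
Qed.

(* In 2 ^+ 13 = 2 * 2 ^+ 8 * 16, the factor 2 pays for the weight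
   #|X| <= 2 ^ #|X|, the factor 2 ^+ 8 for the choice of X among the subsets of
   a set of size at most 8 * #|X|, and the factor 16 for the bound 1 / 16. *)
Lemma halving q : 0 < q <= 1 -> 2 ^+ 13 <= q * k ->
  exists X : {set U} -> {set U} -> {set U},
    (forall S W, S \in F -> exists2 A, A \in F &
       tau A \subset tau S :|: W /\ X S W = tau A :\: W) /\
    \sum_S mu S * (\sum_(W : {set U}) Bin q W * #|X S W|%:R) <=
    (\sum_S mu S * #|tau S|%:R) / 8 + 1 / 16.
Proof.
move=> /andP[q0 q1] qk.
have [c cP] := smallest_below F tau.
pose good S W A := let X := tau A :\: W in
  [&& A \in F, tau A \subset tau S :|: W, X \subset tau (c (W :|: X))
      & (#|tau (c (W :|: X))| <= #|tau S|)%N].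
pose a S W := odflt set0 [pick A | good S W A].
have aP S W : S \in F -> good S W (a S W).
  move=> SF; rewrite /a; case: pickP => [//|/= no].
  have [A [h1 h2 h3 h4]] := fragment_choice W cP SF.
  by move: (no A); rewrite /good h1 h2 h3 h4.
exists (fun S W => tau (a S W) :\: W); split=> [S W SF|].
  by have /and4P[AF AS _ _] := aP S W SF; exists (a S W).
have B0 (W : {set U}) : 0 <= Bin q W by apply: Bin_ge0; rewrite ltW.
pose phi (X Z : {set U}) : R :=
  ((X \subset tau (c Z)) && (#|tau (c Z)| <= 8 * #|X|)%N)%:R * #|X|%:R.
have phi0 X Z : 0 <= phi X Z by rewrite mulr_ge0.
pose P (S X : {set U}) := (X \subset tau S) && (X != set0).
apply: (@le_trans _ _ (\sum_S mu S * (#|tau S|%:R / 8 + \sum_(X | P S X)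
   \sum_(W : {set U} | [disjoint X & W]) Bin q W * phi X (W :|: X)))).
  apply: sum_mu_le => S SF.
  apply: (@le_trans _ _ (\sum_(W : {set U}) Bin q W * (#|tau S|%:R / 8 +
     \sum_(X | P S X) [disjoint X & W]%:R * phi X (W :|: X)))).
    apply: ler_sum => W _; apply: ler_wpM2l => //.
    have /and4P[AF AS Xc cS] := aP S W SF.
    set X := tau (a S W) :\: W in Xc cS *.
    have s0 : 0 <= \sum_(X | P S X) [disjoint X & W]%:R * phi X (W :|: X).
      by apply: sumr_ge0 => X' _; rewrite mulr_ge0.
    (* In the first case X is smaller than [tau S] by a factor 8, because [tau (c (W :|: X))] is no
       larger than [tau S]; otherwise X is paid for by [phi]. *)
    have [big|small] := ltnP (8 * #|X|) #|tau (c (W :|: X))|.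
      apply: (@le_trans _ _ (#|tau S|%:R / 8)); last by rewrite lerDl.
      by rewrite ler_pdivlMr // -natrM ler_nat mulnC (leq_trans (ltnW big)).
    apply: (@le_trans _ _ (\sum_(X | P S X)
      [disjoint X & W]%:R * phi X (W :|: X))); last first.
      by rewrite lerDr divr_ge0.
    have [->|X0] := eqVneq X set0; first by rewrite cards0.
    have PX : P S X by rewrite /P X0 andbT subDset setUC.
    rewrite (bigD1 X) //= /phi Xc small /= mul1r.
    have -> : [disjoint X & W].
      by rewrite /X disjoint_sym disjoints_subset setDE setCI setCK subsetUr.
    by rewrite mul1r lerDl sumr_ge0 // => X' _; rewrite !mulr_ge0.
  under eq_bigr => W _ do rewrite mulrDr mulr_sumr.
  rewrite big_split /= -mulr_suml sum_Bin mul1r lerD2l exchange_big /=.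
  apply: ler_sum => X _; rewrite [X in _ <= X]big_mkcond; apply: ler_sum => W _.
  by case: ifP => _; rewrite ?mul1r ?mul0r ?mulr0.
under eq_bigr => S _ do rewrite mulrDr mulrA.
rewrite big_split /= -mulr_suml lerD2l.
apply: (@le_trans _ _ (\sum_S mu S * (\sum_(X | P S X)
   q ^- #|X| * \sum_(Z : {set U}) Bin q Z * phi X Z))).
  apply: sum_mu_le => S SF; apply: ler_sum => X _.
  rewrite ler_pdivlMl ?exprn_gt0 // mulrC.
  apply: le_trans (@Bin_plant _ _ q X (phi X) _ _) _ => //; first by rewrite ltW.
  rewrite big_mkcond /=; apply: ler_sum => Z _; case: ifP => // _.
  by rewrite mulr_ge0.
rewrite -[1 / 16](Bin_cst U q).
under eq_bigr => S _.
  under eq_bigr => X _ do rewrite mulr_sumr.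
  rewrite exchange_big mulr_sumr /=.
  over.
rewrite exchange_big /=; apply: ler_sum => Z _.
pose c1 := (q * k)^-1.
have term (X : {set U}) : X != set0 ->
    q ^- #|X| * phi X Z * k ^- #|X| <=
    (X \subset tau (c Z))%:R * (2 ^- #|tau (c Z)| * (1 / 16)).
  rewrite -card_gt0 /phi; case: (X \subset _) => /=; last first.
    by rewrite mul0r mulr0 !mul0r.
  have r0 : (0 : R) <= 2 ^- #|tau (c Z)| * (1 / 16).
    by rewrite mulr_ge0 ?divr_ge0 ?invr_ge0 ?exprn_ge0.
  case: (boolP (_ <= 8 * #|X|)%N) => h X0;
    last by rewrite /= mul0r mulr0 mul0r mulr_ge0.
  rewrite !mul1r mulrAC -invfM -exprMn.
  have qk0 : 0 < q * k by rewrite mulr_gt0.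
  have hX : (#|X|%:R : R) <= 2 ^+ #|X|.
    by rewrite -natrX ler_nat ltnW // ltn_expl.
  apply: (@le_trans _ _ ((2 ^+ 13) ^- #|X| * 2 ^+ #|X|)).
    apply: ler_pM => //; first by rewrite invr_ge0 exprn_ge0 // ltW.
    have c0 : (0 : R) < 2 ^+ 13 by rewrite exprn_gt0.
    rewrite lef_pV2 ?posrE; [|exact: exprn_gt0|exact: exprn_gt0].
    by apply: lerXn2r; rewrite ?nnegrE ?(ltW qk0) ?(ltW c0).
  rewrite -exprVn -exprMn (_ : (2 ^+ 13)^-1 * 2 = (2 ^+ 8)^-1 * (1 / 16));
    last by rewrite !exprS expr0; lra.
  have c0 : (0 : R) < 2 ^+ 8 by rewrite exprn_gt0.
  rewrite exprMn; apply: ler_pM;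
    rewrite ?exprn_ge0 ?invr_ge0 ?divr_ge0 ?(ltW c0) //.
    rewrite exprVn lef_pV2 ?posrE; [|exact: exprn_gt0|exact: exprn_gt0].
    by rewrite -exprM ler_eXn2l // ltr1n.
  by rewrite div1r -[X in _ <= X]expr1; apply: (ler_wiXn2l _ _ (X0 : (1 <= _)%N)); lra.
(* The amount 1 / 16 is shared equally among the subsets of [tau (c Z)], so that the two sums
   compare for each X. *)
rewrite (_ : 1 / 16 = \sum_(X in powerset (tau (c Z)))
    2 ^- #|tau (c Z)| * (1 / 16)); last first.
  rewrite sumr_const card_powerset -[RHS]mulr_natl natrX mulrA mulfV ?mul1r //.
  by rewrite gt_eqF ?exprn_gt0.
rewrite big_distrr /= [X in _ <= X]big_mkcond.
under eq_bigr => S _ do rewrite mulr_sumr big_mkcond.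
rewrite exchange_big /=; apply: ler_sum => X _.
have [X0|X0] := eqVneq X set0.
  rewrite big1 => [|S _]; last by rewrite /P X0 eqxx andbF.
  case: ifP => // _.
  by rewrite !mulr_ge0 ?divr_ge0 ?invr_ge0 ?exprn_ge0.
apply: (@le_trans _ _ (Bin q Z * (q ^- #|X| * phi X Z * k ^- #|X|))); last first.
  apply: le_trans (ler_wpM2l (B0 Z) (term X X0)) _.
  by rewrite powersetE; case: ifP => _; rewrite ?mul1r // mul0r mulr0.
have qphi : 0 <= Bin q Z * (q ^- #|X| * phi X Z).
  by rewrite !mulr_ge0 // invr_ge0 exprn_ge0 // ltW.
(* The S counted here contain X through [tau S], so their total mass is at most [k ^- #|X|]. *)
rewrite [X in _ <= X]mulrA; apply: le_trans (ler_wpM2l qphi (mu_spread X0)).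
rewrite /Pr mulr_sumr [X in _ <= X]big_mkcond; apply: ler_sum => S _.
rewrite /P X0 andbT; case: (boolP (S \in F)) => SF; last first.
  by rewrite mu_out // !mul0r mulr0; do 2 case: ifP.
case: ifP => XS; last by case: ifP => // _; rewrite mulr_ge0.
rewrite (subset_trans XS) ?tau_sub //.
by rewrite [X in _ <= X]mulrC [X in _ <= _ * X]mulrCA.
Qed.

End Halving.

(** * Iterated halving of the mean fragment size *)

Section ExpectedFragment.
Variables (R : realType) (U : finType) (k : R) (mu : {set U} -> R).
Local Notation F := (support_of mu).
Hypotheses (mu_prob : prob_measure mu) (mu_spread : spread k mu).
Hypothesis (k0 : 0 < k).

Definition frag_mean (W : {set U}) : R := \sum_S mu S * #|frag F S W|%:R.

Lemma frag_mean_ge0 W : 0 <= frag_mean W.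
Proof. by apply: sumr_ge0 => S _; rewrite mulr_ge0 // mu_ge0. Qed.

Lemma frag_mean_antitone (V W : {set U}) : V \subset W -> frag_mean W <= frag_mean V.
Proof.
by move=> VW; apply: sum_mu_le => // S SF; rewrite ler_nat frag_antitone.
Qed.

Lemma frag_mean_hit (A W : {set U}) : A \in F -> A \subset W -> frag_mean W = 0.
Proof.
move=> AF AW; rewrite /frag_mean big1 // => S _.
have [SF|SF] := boolP (S \in F); first by rewrite (frag_hit SF AF AW) mulr0.
by rewrite (mu_out mu_prob) // mul0r.
Qed.

Lemma frag_mean_miss (W : {set U}) : ~~ [exists A, (A \in F) && (A \subset W)] ->
  1 <= frag_mean W.
Proof.
move=> no; rewrite -(sum_mu mu_prob).
rewrite -[X in X <= _](eq_bigr _ (fun S _ => mulr1 (mu S))).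
apply: sum_mu_le => // S SF; rewrite ler1n card_gt0 setD_eq0.
have [bF _ _] := bestP W SF.
by apply: contraNN no => bW; apply/existsP; exists (best F S W); rewrite bF.
Qed.

(** Apply [halving] with [tau S] the fragment at W0. Either W0 contains a member of [F] and the mean
    is 0, or the mean is at least 1 and absorbs the additive 1 / 16. *)
Lemma frag_mean_halving q W0 : 0 < q <= 1 -> 2 ^+ 13 <= q * k ->
  \sum_(W : {set U}) Bin q W * frag_mean (W0 :|: W) <= frag_mean W0 / 2.
Proof.
move=> q01 qk.
have [/existsP[A /andP[AF AW]]|no] :=
    boolP [exists A, (A \in F) && (A \subset W0)].
  rewrite big1 ?divr_ge0 ?frag_mean_ge0 // => W _.
  by rewrite (frag_mean_hit AF) ?mulr0 // subsetU ?AW.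
have m1 := frag_mean_miss no.
have [X [XP Xle]] := halving mu_prob mu_spread k0
  (fun S => @frag_sub U F S W0) q01 qk.
have B0 (W : {set U}) : 0 <= Bin q W by apply: Bin_ge0; case/andP: q01 => /ltW-> ->.
apply: (@le_trans _ _ (frag_mean W0 / 8 + 1 / 16)); last by lra.
apply: le_trans Xle; under eq_bigr => W _ do rewrite mulr_sumr.
rewrite exchange_big /=.
rewrite [X in X <= _](eq_bigr (fun S => mu S * \sum_(W : {set U}) Bin q W *
    #|frag F S (W0 :|: W)|%:R)); last first.
  by move=> S _; rewrite mulr_sumr; apply: eq_bigr => W _; rewrite mulrCA.
apply: sum_mu_le => // S SF; apply: ler_sum => W _; rewrite ler_wpM2l // ler_nat.
(* [best F A W0] lies in S u W0 u W, and its part outside W0 u W is exactly [X S W]. *)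
have [A AF [AS ->]] := XP S W SF.
have [bF _ _] := bestP W0 AF.
have bA : best F A W0 \subset W0 :|: frag F A W0 by apply: best_sub.
rewrite [X in (_ <= X)%N](_ : _ = #|best F A W0 :\: (W0 :|: W)|); last first.
  by rewrite /frag setDDl.
apply: frag_le => //; apply: subset_trans bA _.
rewrite subUset; apply/andP; split; first by rewrite subsetU // subsetUl orbT.
apply: subset_trans AS _; apply: setUSS; [exact: frag_sub | exact: subsetUr].
Qed.

Definition expected (p : R) : R := \sum_(W : {set U}) Bin p W * frag_mean W.

Lemma expected_antitone p q : 0 <= p -> p <= q -> q <= 1 -> 0 < q ->
  expected q <= expected p.
Proof. by move=> *; apply: Bin_antitone => // V W; apply: frag_mean_antitone. Qed.

(** Adding a fresh set of density q to one of density s gives density [s + q - s * q <= s + q], and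
    [expected] is antitone. *)
Lemma expected_halving p q (n : nat) : 0 <= p -> 0 < q -> 2 ^+ 13 <= q * k ->
  p + n%:R * q <= 1 -> expected (p + n%:R * q) <= expected p / 2 ^+ n.
Proof.
move=> p0 q0 qk; elim: n => [|n IH]; first by rewrite mul0r addr0 expr0 divr1.
rewrite -natr1 mulrDl mul1r addrA => pn1.
have n0 : 0 <= n%:R * q by rewrite mulr_ge0 // ltW.
have q1 : q <= 1 by lra.
have pn : p + n%:R * q <= 1 by lra.
set s := p + n%:R * q in IH pn pn1 *.
have s0 : 0 <= s by rewrite addr_ge0.
apply: (@le_trans _ _ (expected (s + q - s * q))).
  have sq0 : 0 <= s * q by rewrite mulr_ge0 // ltW.
  by apply: expected_antitone; nra.
rewrite exprSr invfM mulrA; apply: le_trans (ler_wpM2r _ (IH pn)); last first.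
  by rewrite invr_ge0.
rewrite /expected -Bin_setU mulr_suml; apply: ler_sum => W _.
rewrite -mulrA; apply: ler_wpM2l; first by apply: Bin_ge0; rewrite s0.
by apply: frag_mean_halving => //; rewrite q0.
Qed.

(** Markov: the mean is at least 1 whenever W contains no member of [F]. *)
Lemma hit_ge p : 0 <= p <= 1 -> 1 - expected p <=
  Pr (Bin p) (fun W : {set U} =>
    [exists S : {set U}, (S \in support_of mu) && (S \subset W)]).
Proof.
move=> p01; rewrite lerBlDr -(sum_Bin U p) /Pr /expected.
rewrite [X in _ <= X + _]big_mkcond -big_split /=; apply: ler_sum => W _.
have B0 := @Bin_ge0 R U p W p01; have f0 := frag_mean_ge0 W.
case: ifPn => [_|no]; first by rewrite lerDl mulr_ge0.
by rewrite add0r ler_peMr // frag_mean_miss.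
Qed.

End ExpectedFragment.

(** * Choice of the constant and conclusion *)

Lemma Pr_Bin1 (R : realType) (U : finType) (E : pred {set U}) : E setT ->
  1 <= Pr (Bin (1 : R)) E.
Proof.
move=> ET; rewrite /Pr (bigD1 setT) //= [X in X + _](_ : _ = 1); last first.
  by rewrite /Bin big1 // => x _; rewrite inE.
by rewrite lerDl sumr_ge0 // => W _; apply: Bin_ge0; rewrite ler01 lexx.
Qed.

(** For [a = d] the left side bounds the mean before halving, and the halvings divide it by at least
    [x ^ 4] with [x = (a + 1) / eps]. It holds because [eps * x = a + 1] and [x >= 4]. *)
Lemma quartic_ratio_ge (R : realType) (a eps : R) : 1 <= a -> 0 < eps ->
  eps <= 1 / 2 -> 16 * a ^+ 2 + 1 <= eps * ((a + 1) / eps) ^+ 4.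
Proof.
move=> a1 eps0 eps2; set x := (a + 1) / eps.
have ax : a + 1 = eps * x by rewrite /x mulrC divfK // gt_eqF.
have x4 : 4 <= x by rewrite /x ler_pdivlMr //; nra.
have xx : a + 1 <= x by rewrite ax; nra.
have -> : eps * x ^+ 4 = (a + 1) * x ^+ 3 by rewrite ax; ring.
have x3 : 16 * (a + 1) <= x ^+ 3.
  have -> : x ^+ 3 = x * x * x by ring.
  have : 4 * 4 <= x * x by nra.
  nra.
nra.
Qed.

Theorem theorem1p3 (R : realType) :
  exists C : R, 0 < C /\
    forall (U : finType) (k : R) (mu : {set U} -> R) (d : nat) (eps : R),
      1 <= k ->
      prob_measure mu ->
      spread k mu ->
      (1 <= d)%N ->
      (VC (support_of mu) <= d)%N ->
      0 < eps -> eps <= 1 / 2 ->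
      let p := Num.min 1 (C / k * ln ((d%:R + 1) / eps)) in
      1 - eps <=
        Pr (Bin p) (fun W : {set U} =>
          [exists S : {set U}, (S \in support_of mu) && (S \subset W)]).
Proof.
have [c c0 cE] : exists2 c : R, 0 < c & c = 2 ^+ 13.
  by exists (2 ^+ 13) => //; apply: exprn_gt0.
(* Sprinkling takes density at most [64 / k], and at most [9 * L] halving rounds take [c / k]
   each. *)
pose C : R := 64 + 9 * c.
have C0 : 0 < C by rewrite /C; lra.
exists C; split=> // U k mu d eps k1 mu_prob mu_spread d1 VCd eps0 eps2.
cbv zeta; set p := Num.min _ _.
have k0 : 0 < k by lra.
set x := (d%:R + 1) / eps in p *.
have dR : (1 : R) <= d%:R by rewrite ler1n.
have x4 : 4 <= x by rewrite /x ler_pdivlMr //; nra.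
have x0 : 0 < x by lra.
set L := ln x in p *.
have L1 : 1 <= L.
  rewrite -[X in X <= _](@expRK R) ler_ln ?posrE ?expR_gt0 //.
  by apply: le_trans x4; apply: expR1_le4.
have [le1|lt1] := lerP 1 (C / k * L).
  rewrite /p (min_idPl le1); apply: (@le_trans _ _ 1); first by lra.
  apply: Pr_Bin1.
  have [S SF] : exists S, S \in support_of mu.
    apply/existsP; apply: contraT; rewrite negb_exists => /forallP no.
    have := sum_mu mu_prob; rewrite big1 => [/esym/eqP|S _].
      by rewrite oner_eq0.
    by rewrite (mu_out mu_prob).
  by apply/existsP; exists S; rewrite SF subsetT.
have -> : p = C / k * L by rewrite /p; apply/min_idPr/ltW.
have CLk : C * L < k by move: lt1; rewrite mulrAC ltr_pdivrMr ?mul1r.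
have k64 : 64 <= k by rewrite /C in CLk; nra.
pose D := (16 * d ^ 2)%N; pose q : R := c / k.
(* More than [8 * L] rounds are wanted, and rounding up adds at most [L] since [1 <= L]. *)
pose n := (Num.truncn (8 * L)).+1.
have /andP[nl nu] : 8 * L < n%:R <= 9 * L.
  have /andP[h1 h2] := @truncn_itv R (8 * L) ltac:(lra).
  by rewrite h2 /n -natr1 /=; lra.
have q0 : 0 < q by rewrite divr_gt0.
have qk : q * k = c by rewrite divfK // gt_eqF.
have dD : (d <= D)%N.
  by rewrite /D -mulnn (leq_trans (leq_pmulr d d1)) // leq_pmull.
have /andP[_ pD] := density_bounds k64 d1 dD.
have pD0 := density_gt0 k64 d1 dD.
have pq : density k d D + n%:R * q <= C / k * L.
  have -> : C / k * L = 64 / k * L + 9 * L * q by rewrite /q /C; ring.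
  apply: lerD; last by rewrite ler_wpM2r // ltW.
  by apply: le_trans pD _; rewrite ler_peMr // divr_ge0 // ltW.
have P0 : 0 < C / k * L by apply: mulr_gt0; [exact: divr_gt0 | lra].
apply: le_trans (hit_ge mu_prob _); last first.
  by rewrite (ltW P0) (ltW lt1).
rewrite lerD2l lerN2.
have nq0 : 0 <= n%:R * q by rewrite mulr_ge0 // ltW.
apply: (@le_trans _ _ (expected mu (density k d D + n%:R * q))).
  apply: expected_antitone => //; last exact: ltW.
  by rewrite addr_ge0 // ltW.
apply: le_trans (expected_halving mu_prob mu_spread k0 (ltW pD0) q0 _ _) _.
- by rewrite qk cE.
- by apply: le_trans pq (ltW lt1).
rewrite ler_pdivrMr ?exprn_gt0 //.
have eD : expected mu (density k d D) <= D%:R + 1.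
  apply: le_trans (expected_frag_le mu_prob mu_spread k64 VCd d1).
  rewrite /expected; under eq_bigr => W _ do rewrite /frag_mean mulr_sumr.
  rewrite exchange_big /=; apply: ler_sum => S _; rewrite mulr_sumr.
  by apply: ler_sum => W _; rewrite mulrCA.
apply: le_trans eD _.
(* [8 * L < n] and [expR (1 / 2) <= 2] give [x ^ 4 = expR (4 * L) <= 2 ^ n]. *)
have x_n : x ^+ 4 <= 2 ^+ n.
  have h : expR (1 / 2 : R) <= 2.
    have := expR_ge1Dx (- (1 / 2) : R); have e0 := expR_gt0 (1 / 2 : R).
    by rewrite expRN -(ler_pM2l e0) mulfV ?gt_eqF //; lra.
  apply: (@le_trans _ _ (expR (1 / 2) ^+ n)); last first.
    by apply: lerXn2r; rewrite ?nnegrE ?expR_ge0.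
  rewrite -[x]lnK ?posrE // -!expRM_natl ler_expR -/L; lra.
apply: (@le_trans _ _ (eps * x ^+ 4)); last by rewrite ler_wpM2l // ltW.
have -> : D%:R = 16 * d%:R ^+ 2 :> R by rewrite /D natrM natrX.
exact: quartic_ratio_ge.
Qed.
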